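(* Let $E$ and $F$ be Banach spaces. Suppose there exist a weakly unconditionally Cauchy sequence $(x_n)_n$ in $E$, a sequence $(x_n^* )_n$ in the closed unit ball $B_{E^*}$ of $E^*$, an element $x^{**} \in E^{**}$ and a real number $\epsilon > 0$ such that $x_n^*(x_n) = 1$ and $x^{**}(x_n^* ) > \epsilon$ for every $n \in \mathbb{N}$. If $F$ has a copy of $\ell_1$, then $\Pi_1(E,F)$ has a complemented copy of $\ell_1$.
   Context: For Banach spaces $E,F$, a bounded linear operator $T: E \to F$ is absolutely 1-summing if $\sum_{n=1}^\infty \|T x_n\| < \infty$ for every sequence $(x_n)_n$ in $E$ such that $\sum_{n=1}^\infty |x^*(x_n)| < \infty$ for each $x^* \in E^*$. $\Pi_1(E,F)$ denotes the Banach space of all absolutely 1-summing operators from $E$ to $F$ with the norm $\pi_1(T) = \inf\{\rho > 0 : \sum_{i=1}^n \|T x_i\| \le \rho \sup_{x^* \in B_{E^*}} \sum_{i=1}^n |x^*(x_i)| \text{ for all } n \in \mathbb{N} \text{ and all } x_1,\dots,x_n \in E\}$. A sequence $(x_n)_n$ in $E$ is weakly unconditionally Cauchy if $\sum_{n=1}^\infty |x^*(x_n)| < \infty$ for every $x^* \in E^*$. A Banach space has a copy of $\ell_1$ if it has a closed subspace linearly homeomorphic to $\ell_1$; it has a complemented copy of $\ell_1$ if it has such a subspace that is the range of a bounded linear projection on the whole space. *)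

(* Defs.v *)
From HB Require Import structures.
From mathcomp Require Import all_boot all_order all_algebra.
From mathcomp Require Import all_classical all_reals all_analysis.
Set Implicit Arguments.
Unset Strict Implicit.
Unset Printing Implicit Defensive.
Import Order.TTheory GRing.Theory Num.Theory.
Import numFieldNormedType.Exports.
Local Open Scope classical_set_scope.
Local Open Scope ring_scope.

(* Real scalars throughout. For a normed space E, its dual is the normed space
   bop E R^o of bounded linear functionals, and its bidual is
   bop (bop E R^o) R^o. *)

Section BoundedOperators.
Context {R : realType} (E F : normedModType R).

Definition is_bop : {pred E -> F} :=
  [pred f | `[< linear f /\ exists M : R, forall x, `|f x| <= M * `|x| >]].

Record bop := Bop { bop_fun :> E -> F; bopP : bop_fun \in is_bop }.

HB.instance Definition _ := [isSub for bop_fun].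
HB.instance Definition _ := [Choice of bop by <:].

Lemma is_bop_submod_closed : submod_closed is_bop.
Proof.
split.
- apply/asboolP; split.
    by move=> a x y /=; rewrite scaler0 addr0.
  by exists 0 => x; rewrite normr0 mul0r.
- move=> a f g /asboolP[lf [Mf bf]] /asboolP[lg [Mg bg]].
  apply/asboolP; split.
    move=> b x y; rewrite !fctE lf lg !scalerDr !scalerA mulrC.
    by rewrite addrACA.
  exists (`|a| * Mf + Mg) => x; rewrite !fctE (le_trans (ler_normD _ _))//.
  rewrite mulrDl lerD// normrZ -mulrA ler_wpM2l//.
Qed.

HB.instance Definition _ :=
  GRing.isSubmodClosed.Build R (E -> F) is_bop is_bop_submod_closed.
HB.instance Definition _ := [SubChoice_isSubLmodule of bop by <:].

Lemma bop_is_linear (f : bop) : linear f.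
Proof. by have /asboolP[] := bopP f. Qed.

HB.instance Definition _ (f : bop) :=
  GRing.isLinear.Build R E F *:%R f (bop_is_linear f).

Definition opnorm (f : bop) : R := sup [set `|f x| | x in [set x | `|x| <= 1]].

Lemma opnorm_has_sup (f : bop) :
  has_sup [set `|f x| | x in [set x | `|x| <= 1]].
Proof.
split; first by exists `|f 0|, 0 => //=; rewrite normr0.
have /asboolP[_ [M Mf]] := bopP f.
exists `|M| => _ [x /= x1 <-]; rewrite (le_trans (Mf x))//.
by rewrite (le_trans (ler_wpM2r _ (ler_norm M)))// ler_piMr.
Qed.

Lemma opnorm_ge0 (f : bop) : 0 <= opnorm f.
Proof.
apply: le_trans (normr_ge0 (f 0)) _; apply: ub_le_sup.
  by case: (opnorm_has_sup f).
by exists 0 => //=; rewrite normr0.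
Qed.

Lemma opnorm_bound (f : bop) x : `|f x| <= opnorm f * `|x|.
Proof.
have [->|x0] := eqVneq x 0; first by rewrite linear0 !normr0 mulr0.
have nx : 0 < `|x| by rewrite normr_gt0.
rewrite -ler_pdivrMr// mulrC.
have -> : `|x|^-1 * `|f x| = `|f (`|x|^-1 *: x)|.
  by rewrite linearZ normrZ gtr0_norm ?invr_gt0.
apply: ub_le_sup; first by case: (opnorm_has_sup f).
exists (`|x|^-1 *: x) => //=.
by rewrite normrZ gtr0_norm ?invr_gt0// mulVf ?gt_eqF.
Qed.

Lemma opnorm_le (f : bop) M :
  0 <= M -> (forall x, `|f x| <= M * `|x|) -> opnorm f <= M.
Proof.
move=> M0 Mf; apply: ge_sup; first by case: (opnorm_has_sup f).
by move=> _ [x /= x1 <-]; rewrite (le_trans (Mf x))// ler_piMr.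
Qed.

Lemma opnormD f g : opnorm (f + g) <= opnorm f + opnorm g.
Proof.
apply: opnorm_le => [|x]; first by rewrite addr_ge0 ?opnorm_ge0.
rewrite (le_trans (ler_normD _ _))// mulrDl.
by rewrite lerD// opnorm_bound.
Qed.

Lemma opnormZ (a : R) f : opnorm (a *: f) = `|a| * opnorm f.
Proof.
have ub b g : opnorm (b *: g) <= `|b| * opnorm g.
  apply: opnorm_le => [|x]; first by rewrite mulr_ge0 ?opnorm_ge0.
  by rewrite normrZ -mulrA ler_wpM2l// opnorm_bound.
apply/eqP; rewrite eq_le ub/=.
have [->|a0] := eqVneq a 0; first by rewrite normr0 mul0r opnorm_ge0.
have := ub a^-1 (a *: f); rewrite scalerA mulVf// scale1r normfV.
by rewrite mulrC ler_pdivlMr ?normr_gt0// mulrC.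
Qed.

Lemma opnorm_eq0 f : opnorm f = 0 -> f = 0.
Proof.
move=> f0; apply/val_inj/funext => x; apply/eqP.
by rewrite -normr_le0 (le_trans (opnorm_bound f x))// f0 mul0r.
Qed.

HB.instance Definition _ :=
  Lmodule_isNormed.Build R bop opnormD opnormZ opnorm_eq0.

Lemma bop_normE (f : bop) : `|f| = opnorm f. Proof. by []. Qed.

End BoundedOperators.


Section WeaklySummable.
Context {R : realType} {E : normedModType R}.
Implicit Types (f : bop E R^o).

Definition weakly_unc_cauchy (x : nat -> E) :=
  forall f : bop E R^o, (\sum_(0 <= n <oo) (`|f (x n)|)%:E < +oo)%E.

(* The set below is nonempty and bounded above (weak1_has_sup), so sup is not
   the junk value. *)
Definition weak1 n (x : 'I_n -> E) : R :=
  sup [set \sum_(i < n) `|f (x i)| | f in [set f : bop E R^o | `|f| <= 1]].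

Lemma weak1_has_sup n (x : 'I_n -> E) :
  has_sup [set \sum_(i < n) `|f (x i)| | f in [set f : bop E R^o | `|f| <= 1]].
Proof.
split; first by eexists; exists 0 => //=; rewrite normr0.
exists (\sum_(i < n) `|x i|) => _ [f /= f1 <-]; apply: ler_sum => i _.
by rewrite (le_trans (opnorm_bound f (x i)))// ler_piMl.
Qed.

Lemma weak1_ge0 n (x : 'I_n -> E) : 0 <= weak1 x.
Proof.
rewrite /weak1; apply: ub_le_sup; first by case: (weak1_has_sup x).
exists 0 => /=; first by rewrite normr0.
by rewrite big1// => i _; rewrite normr0.
Qed.

Lemma weak1_bound n (x : 'I_n -> E) f :
  \sum_(i < n) `|f (x i)| <= `|f| * weak1 x.
Proof.
have [f0|f0] := eqVneq f 0.
  rewrite big1 => [|i _]; first by rewrite mulr_ge0 ?weak1_ge0.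
  by rewrite f0 normr0.
have nf : 0 < `|f| by rewrite normr_gt0.
rewrite -ler_pdivrMl//; apply: ub_le_sup; first by case: (weak1_has_sup x).
exists (`|f|^-1 *: f) => /=.
  by rewrite normrZ gtr0_norm ?invr_gt0// mulVf ?gt_eqF.
rewrite mulr_sumr; apply: eq_bigr => i _.
by rewrite -[LHS]/(`|(`|f|^-1 *: (f (x i)))|) normrZ gtr0_norm// invr_gt0.
Qed.

Lemma weak1_le_sum n (x : 'I_n -> E) : weak1 x <= \sum_(i < n) `|x i|.
Proof.
apply: ge_sup; first by case: (weak1_has_sup x).
move=> _ [f /= f1 <-]; apply: ler_sum => i _.
by rewrite (le_trans (opnorm_bound f (x i)))// ler_piMl.
Qed.

End WeaklySummable.

Section AbsolutelySummingOperators.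
Context {R : realType} (E F : normedModType R).
Implicit Types T U : bop E F.

Definition abs1summing : {pred bop E F} := [pred T | `[< forall x : nat -> E,
  weakly_unc_cauchy x -> (\sum_(0 <= n <oo) (`|(T : bop E F) (x n)|)%:E < +oo)%E >]].

Definition pi1_bound T (rho : R) := forall n (x : 'I_n -> E),
  \sum_(i < n) `|T (x i)| <= rho * weak1 x.

(* For T \in abs1summing some rho is admissible (abs1summing_bounded), so that
   this infimum is a norm on the type Pi1 of absolutely 1-summing operators; it
   is unrelated to the operator norm inherited through the coercion to bop. *)
Definition pi1 T : R := inf [set rho : R | 0 < rho /\ pi1_bound T rho].

Record Pi1 := MkPi1 { Pi1_bop :> bop E F; Pi1P : Pi1_bop \in abs1summing }.

HB.instance Definition _ := [isSub for Pi1_bop].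
HB.instance Definition _ := [Choice of Pi1 by <:].

Lemma abs1summing_submod_closed : submod_closed abs1summing.
Proof.
split.
  apply/asboolP => x _; rewrite eseries0// => i _ _ /=.
  by rewrite normr0.
move=> a T U /asboolP hT /asboolP hU; apply/asboolP => x xw.
have hle : (\sum_(0 <= n <oo) (`|(a *: T + U) (x n)|)%:E <=
   \sum_(0 <= n <oo) (`|a|%:E * `|T (x n)|%:E + `|U (x n)|%:E))%E.
  apply: lee_nneseries => [i _ _|n _]; first by rewrite lee_fin.
  by rewrite -EFinM -EFinD lee_fin -normrZ ler_normD.
apply: le_lt_trans hle _.
rewrite nneseriesD; [|by move=> *; rewrite ?mule_ge0 ?lee_fin..].
rewrite nneseriesZl; last by move=> *; rewrite lee_fin.
apply: lte_add_pinfty; last exact: hU.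
by apply: lte_mul_pinfty; rewrite ?lee_fin//; exact: hT.
Qed.

HB.instance Definition _ := GRing.isSubmodClosed.Build R (bop E F) abs1summing
  abs1summing_submod_closed.
HB.instance Definition _ := [SubChoice_isSubLmodule of Pi1 by <:].

Lemma nneseries_concat (n : nat -> nat) (x : forall k, 'I_(n k) -> E) :
  exists z : nat -> E, forall G : E -> R, (forall y, 0 <= G y) -> G 0 = 0 ->
  (\sum_(0 <= m <oo) (G (z m))%:E =
   \sum_(0 <= k <oo) (\sum_(i < n k) G (x k i))%:E)%E.
Proof.
pose xx k j := if insub j is Some i then x k i else 0.
have [e] : $|{bij [set: nat] >-> [set: nat * nat]}|.
  by apply/pcard_eqP; rewrite card_eq_sym; exact: card_nat2.
exists (fun m => xx (e m).1 (e m).2) => G G0 Gz.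
rewrite nneseries_esumT; last by move=> m; rewrite lee_fin.
have be : set_bij [set: nat] [set: nat * nat] e by exact: bij.
rewrite -(@reindex_esum R _ _ _ _ e (fun p => (G (xx p.1 p.2))%:E) be).
have -> : [set: nat * nat] = [set: nat] `*`` (fun=> [set: nat]).
  by apply/seteqP; split.
rewrite -(@esum_esum R _ _ _ _ (fun k j => (G (xx k j))%:E))//; last first.
  by move=> *; rewrite lee_fin.
rewrite -nneseries_esumT; last first.
  by move=> k; apply: esum_ge0 => j _; rewrite lee_fin.
apply: eq_eseriesr => k _.
rewrite -nneseries_esumT; last by move=> j; rewrite lee_fin.
rewrite (nneseries_split 0 (n k)); last by move=> *; rewrite lee_fin.
rewrite [X in (_ + X)%E]eseries0 ?adde0 => [|j /= nj _]; last first.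
  by rewrite /xx insubF ?Gz//; rewrite ltnNge nj.
rewrite big_mkord sumEFin; congr EFin; apply: eq_bigr => i _.
by rewrite /xx valK.
Qed.

Lemma abs1summing_bounded T : T \in abs1summing ->
  exists rho : R, 0 < rho /\ pi1_bound T rho.
Proof.
move=> /asboolP hT; apply: contrapT => /forallNP hN.
have step k : exists nx : {n & 'I_n -> E},
    \sum_(i < projT1 nx) `|T (projT2 nx i)| = 1 /\
    forall f : bop E R^o,
      \sum_(i < projT1 nx) `|f (projT2 nx i)| <= `|f| / (2 ^ k.+1)%:R.
  have /existsNP[n /existsNP[x /negP]] : ~ pi1_bound T (2 ^ k.+1)%:R.
    by move=> b; apply: (hN (2 ^ k.+1)%:R); split=> //; rewrite ltr0n expn_gt0.
  rewrite -ltNge => hx; set s := \sum_(i < n) _ in hx.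
  have p0 : 0 < (2 ^ k.+1)%:R :> R by rewrite ltr0n expn_gt0.
  have s0 : 0 < s by rewrite (le_lt_trans _ hx)// mulr_ge0 ?weak1_ge0// ltW.
  exists (existT _ n (fun i => s^-1 *: x i)) => /=; split.
    under eq_bigr do rewrite linearZ normrZ gtr0_norm ?invr_gt0//.
    by rewrite -mulr_sumr mulVf// gt_eqF.
  move=> f.
  under eq_bigr do rewrite linearZ normrZ gtr0_norm ?invr_gt0//.
  rewrite -mulr_sumr ler_pdivrMl//.
  rewrite (le_trans (weak1_bound x f))// mulrCA ler_wpM2l//.
  by rewrite ler_pdivlMr// mulrC ltW.
have [nx hnx] := choice step.
have [z hz] := nneseries_concat (fun k => projT2 (nx k)).
have zw : weakly_unc_cauchy z.
  move=> f; rewrite (hz (fun y => `|f y|))//; last by rewrite linear0 normr0.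
  apply: le_lt_trans (ltry `|f|).
  apply: le_trans (epsilon_trick0 xpredT (normr_ge0 f)).
  apply: lee_nneseries => [k _ _|k _]; rewrite lee_fin ?sumr_ge0//.
  by case: (hnx k).
have := hT _ zw; rewrite (hz (fun y => `|T y|))//; last by rewrite linear0 normr0.
under eq_eseriesr => k _ do rewrite (proj1 (hnx k)).
set S := (X in (X < _)%E) => Soo.
have S0 : (0 <= S)%E by apply: nneseries_ge0 => *; rewrite lee_fin.
have /fineK Sf : S \is a fin_num by rewrite ge0_fin_numE.
have /(_ (Num.truncn (fine S)).+1) := 
  @nneseries_lim_ge R (fun=> 1%:E) xpredT 0 _ (fun _ _ _ => lee01).
rewrite sumEFin sumr_const_nat subn0 -/S -Sf lee_fin.
by rewrite leNgt truncnS_gt.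
Qed.

Lemma pi1_has_inf (T : Pi1) : has_inf [set rho : R | 0 < rho /\ pi1_bound T rho].
Proof.
split; last by exists 0 => r [/ltW].
by have [r hr] := abs1summing_bounded (Pi1P T); exists r.
Qed.

Lemma pi1_ge0 (T : Pi1) : 0 <= pi1 T.
Proof. by apply: lb_le_inf => [|r [/ltW]//]; case: (pi1_has_inf T). Qed.

Lemma pi1_boundP (T : Pi1) : pi1_bound T (pi1 T).
Proof.
move=> n x; apply/ler_addgt0Pr => e e0.
have w0 : 0 < weak1 x + 1 by rewrite ltr_wpDl ?weak1_ge0.
have [r [_ br] rlt] := inf_adherent (divr_gt0 e0 w0) (pi1_has_inf T).
rewrite (le_trans (br n x))//.
rewrite (le_trans (ler_wpM2r (weak1_ge0 x) (ltW rlt)))// mulrDl lerD2l.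
by rewrite mulrAC ler_pdivrMr// ler_wpM2l// ?lerDl// ltW.
Qed.

Lemma pi1_le T rho : 0 <= rho -> pi1_bound T rho -> pi1 T <= rho.
Proof.
move=> r0 br; apply/ler_addgt0Pr => e e0; apply: ge_inf.
  by exists 0 => r [/ltW].
split; first by rewrite ltr_wpDl.
move=> n x; rewrite (le_trans (br n x))// ler_wpM2r ?weak1_ge0//.
by rewrite lerDl ltW.
Qed.

Lemma pi1_op_bound (T : Pi1) x : `|T x| <= pi1 T * `|x|.
Proof.
have := @pi1_boundP T 1 (fun=> x); rewrite big_ord1 => /le_trans; apply.
rewrite ler_wpM2l ?pi1_ge0//.
by have := weak1_le_sum (fun _ : 'I_1 => x); rewrite big_ord1.
Qed.

Lemma pi1D (T U : Pi1) : pi1 (T + U : Pi1) <= pi1 T + pi1 U.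
Proof.
apply: pi1_le => [|n x]; first by rewrite addr_ge0 ?pi1_ge0.
rewrite mulrDl (le_trans _ (lerD (pi1_boundP T x) (pi1_boundP U x)))//.
by rewrite -big_split/=; apply: ler_sum => i _; exact: ler_normD.
Qed.

Lemma pi1Z (a : R) (T : Pi1) : pi1 (a *: T : Pi1) = `|a| * pi1 T.
Proof.
have ub b (U : Pi1) : pi1 (b *: U : Pi1) <= `|b| * pi1 U.
  apply: pi1_le => [|n x]; first by rewrite mulr_ge0 ?pi1_ge0.
  rewrite -mulrA (le_trans _ (ler_wpM2l (normr_ge0 b) (pi1_boundP U x)))//.
  by rewrite mulr_sumr; apply: ler_sum => i _; rewrite -normrZ.
apply/eqP; rewrite eq_le ub andTb.
have [->|a0] := eqVneq a 0; first by rewrite normr0 mul0r pi1_ge0.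
have := ub a^-1 (a *: T); rewrite scalerA mulVf// scale1r normfV.
by rewrite mulrC ler_pdivlMr ?normr_gt0// mulrC.
Qed.

Lemma pi1_eq0 (T : Pi1) : pi1 T = 0 -> T = 0.
Proof.
move=> T0; do 2!apply/val_inj; apply/funext => x; apply/eqP.
by rewrite -normr_le0 (le_trans (pi1_op_bound T x))// T0 mul0r.
Qed.

HB.instance Definition _ :=
  Lmodule_isNormed.Build R Pi1 (norm := fun T : Pi1 => pi1 T) pi1D pi1Z pi1_eq0.

Lemma Pi1_normE (T : Pi1) : `|T| = pi1 T. Proof. by []. Qed.

End AbsolutelySummingOperators.

Section SequenceSpaceL1.
Context {R : realType}.

Definition is_l1 : {pred nat -> R} :=
  [pred u | (\sum_(0 <= n <oo) (`|(u : nat -> R) n|)%:E < +oo)%E].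

Record l1 := MkL1 { l1_seq :> nat -> R; l1P : l1_seq \in is_l1 }.

HB.instance Definition _ := [isSub for l1_seq].
HB.instance Definition _ := [Choice of l1 by <:].

Lemma l1_sumD (u v : nat -> R) : (\sum_(0 <= n <oo) (`|(u + v) n|)%:E <=
  \sum_(0 <= n <oo) (`|u n|)%:E + \sum_(0 <= n <oo) (`|v n|)%:E)%E.
Proof.
rewrite -nneseriesD; [|by move=> *; rewrite lee_fin..].
apply: lee_nneseries => [i _ _|n _]; first by rewrite lee_fin.
by rewrite -EFinD lee_fin; exact: ler_normD.
Qed.

Lemma l1_sumZ (a : R) (u : nat -> R) : (\sum_(0 <= n <oo) (`|(a *: u) n|)%:E =
  `|a|%:E * \sum_(0 <= n <oo) (`|u n|)%:E)%E.
Proof.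
rewrite -nneseriesZl; last by move=> *; rewrite lee_fin.
by apply: eq_eseriesr => n _; rewrite -EFinM -normrM.
Qed.

Lemma is_l1_submod_closed : submod_closed is_l1.
Proof.
split.
  by rewrite inE eseries0// => i _ _ /=; rewrite normr0.
move=> a u v; rewrite !inE => hu hv; apply: le_lt_trans (l1_sumD _ _) _.
rewrite l1_sumZ; apply: lte_add_pinfty => //.
by apply: lte_mul_pinfty; rewrite ?lee_fin.
Qed.

HB.instance Definition _ :=
  GRing.isSubmodClosed.Build R (nat -> R) is_l1 is_l1_submod_closed.
HB.instance Definition _ := [SubChoice_isSubLmodule of l1 by <:].

Definition l1norm (u : l1) : R := fine (\sum_(0 <= n <oo) (`|u n|)%:E)%E.

Lemma l1norm_fine (u : l1) :
  ((l1norm u)%:E = \sum_(0 <= n <oo) (`|u n|)%:E)%E.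
Proof.
rewrite /l1norm fineK// ge0_fin_numE; first by have := l1P u; rewrite inE.
by apply: nneseries_ge0 => *; rewrite lee_fin.
Qed.

Lemma l1normD (u v : l1) : l1norm (u + v) <= l1norm u + l1norm v.
Proof. by rewrite -lee_fin EFinD !l1norm_fine; exact: l1_sumD. Qed.

Lemma l1normZ (a : R) (u : l1) : l1norm (a *: u) = `|a| * l1norm u.
Proof. by apply: EFin_inj; rewrite EFinM !l1norm_fine; exact: l1_sumZ. Qed.

Lemma l1norm_eq0 (u : l1) : l1norm u = 0 -> u = 0.
Proof.
move=> u0; apply/val_inj/funext => n /=; apply/eqP.
rewrite -normr_le0 -u0 -lee_fin l1norm_fine.
apply: le_trans (nneseries_lim_ge n.+1 _); last by move=> *; rewrite lee_fin.
rewrite big_nat_recr//= leeDr// sumEFin lee_fin; exact: sumr_ge0.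
Qed.

HB.instance Definition _ :=
  Lmodule_isNormed.Build R l1 l1normD l1normZ l1norm_eq0.

Lemma l1_normE (u : l1) :
  (`|u|%:E = \sum_(0 <= n <oo) (`|u n|)%:E)%E.
Proof. exact: l1norm_fine. Qed.

End SequenceSpaceL1.
Arguments l1 R : clear implicits.

Section CopiesOfL1.
Context {R : realType} (X : normedModType R).

Definition closed_subspace (S : set X) := submod_closed (mem S) /\ closed S.

(* The inverse homeomorphism S -> l1 is given by G, whose values outside S are
   irrelevant. *)
Definition homeomorphic_to_l1 (S : set X) :=
  exists (J : {linear l1 R -> X}) (G : X -> l1 R),
    [/\ continuous J, J @` setT = S, cancel J G & {within S, continuous G}].

Definition has_copy_l1 :=
  exists S : set X, closed_subspace S /\ homeomorphic_to_l1 S.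

Definition has_complemented_copy_l1 :=
  exists S : set X, [/\ closed_subspace S, homeomorphic_to_l1 S &
    exists P : bop X X, (forall x, P (P x) = P x) /\ P @` setT = S].

End CopiesOfL1.

(* Main.v *)
Require Import Defs.
From HB Require Import structures.
From mathcomp Require Import all_boot all_order all_algebra.
From mathcomp Require Import all_classical all_reals all_analysis.
From mathcomp Require Import lra.
Import Order.TTheory GRing.Theory Num.Theory.
Import numFieldNormedType.Exports.
Local Open Scope classical_set_scope.
Local Open Scope ring_scope.

(** The projection is built by factoring the identity of l1 through the space
of absolutely 1-summing operators.

Let J : l1 -> F be the given isomorphic embedding. A sequence a in l1 yields
the diagonal operator sending y to J applied to the sequence a_n x_n^*(y). Its
1-summing norm is at most |J| |a|: for finitely many points y_i, summing
|a_n| |x_n^*(y_i)| first over i costs at most the weak 1-norm of the y_i for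
each n, because x_n^* lies in the dual unit ball ([multiplied_sum_le]). So
[diag_op] is a bounded linear map from l1 to Pi1 E F.

In the other direction, the coordinate functionals of l1, carried to J(l1), are
bounded uniformly in n because J is an isomorphism onto its range;
Hahn-Banach extends them to functionals g_n on F with one common bound
([l1_biorthogonal]). An operator T is mapped to the sequence g_n(T x_n). It is
in l1 because T is 1-summing and x is weakly unconditionally Cauchy, and the
map [evaluation] so obtained is bounded because the weak 1-norms of the initial
segments of x are bounded ([wuc_weak1_bounded], by the uniform boundedness
principle on the dual of E).

On the diagonal operator of a, the n-th term of the evaluation is
g_n(J(a_k x_k^*(x_n))_k) = a_n x_n^*(x_n) = a_n, so evaluation is a left inverse
of diag_op. Evaluation followed by diag_op is then a bounded projection onto the
range of diag_op, which is a copy of l1 ([complemented_copy_of_retraction]). *)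

(** * The Hahn-Banach theorem for a sublinear functional *)

Section HahnBanach.
Context {R : realType} {X : lmodType R}.
Implicit Types p q m : X -> R.

Definition sublinear p := (forall x y, p (x + y) <= p x + p y) /\
  (forall t x, 0 <= t -> p (t *: x) = t * p x).

Lemma sublinear0 {p} : sublinear p -> p 0 = 0.
Proof. by move=> [_ pZ]; rewrite -(scale0r (0 : X)) pZ// mul0r. Qed.

Lemma sublinear_opp_ge {p} x : sublinear p -> - p (- x) <= p x.
Proof.
move=> sp; have [pD _] := sp.
by rewrite lerNl -subr_ge0 opprK addrC -(sublinear0 sp) -(subrr x) pD.
Qed.

(** For a convex cone C of constraints (y, r) that p satisfies in the weak form
r <= p y, the infimum of p (x + y) - r over C is a sublinear functional below p
that satisfies them in the strong form q (- y) <= - r. A linear functional below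
q is then at least r at y. Both the ray of a single vector and the graph of a
linear functional are used as C. *)
Lemma sublinear_depress p (C : set (X * R)) : sublinear p ->
  C (0, 0) -> (forall y r z s, C (y, r) -> C (z, s) -> C (y + z, r + s)) ->
  (forall t y r, 0 <= t -> C (y, r) -> C (t *: y, t * r)) ->
  (forall y r, C (y, r) -> r <= p y) ->
  exists q, [/\ sublinear q, forall x, q x <= p x &
    forall y r, C (y, r) -> q (- y) <= - r].
Proof.
move=> sp C0 CD CZ Cp; have [pD pZ] := sp.
pose A x := [set p (x + c.1) - c.2 | c in C].
(* As r <= p y, subadditivity bounds all these values below by - p (- x). *)
have infA x : has_inf (A x).
  split; first by exists (p (x + 0) - 0), (0, 0).
  exists (- p (- x)) => _ [[y r] /= Cyr <-].
  have := Cp _ _ Cyr; have := pD (x + y) (- x); rewrite addrAC subrr add0r; lra.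
have qub x y r : C (y, r) -> inf (A x) <= p (x + y) - r.
  by move=> Cyr; apply: ge_inf; [case: (infA x)|exists (y, r)].
have qlb x z : (forall y r, C (y, r) -> z <= p (x + y) - r) -> z <= inf (A x).
  move=> zA; apply: lb_le_inf; first by case: (infA x).
  by move=> _ [[y r] /= Cyr <-]; exact: zA.
have qZ t x : 0 < t -> t * inf (A x) <= inf (A (t *: x)).
  move=> t0; apply/qlb => y r Cyr.
  have tV0 : 0 <= t^-1 by rewrite invr_ge0 ltW.
  have := qub x _ _ (CZ _ _ _ tV0 Cyr).
  rewrite -(ler_pM2l t0) mulrBr -(pZ _ _ (ltW t0)) scalerDr scalerA mulrA.
  by rewrite mulfV ?gt_eqF// scale1r mul1r.
exists (fun x => inf (A x)); split.
- split=> [x x'|t x] /=.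
    rewrite -lerBlDr; apply/qlb => y r Cyr.
    rewrite lerBlDr -lerBlDl; apply/qlb => y' r' Cyr'.
    have := qub (x + x') _ _ (CD _ _ _ _ Cyr Cyr').
    have := pD (x + y) (x' + y'); rewrite addrACA; lra.
  rewrite le_eqVlt => /predU1P[<-|t0].
    rewrite mul0r scale0r; apply/eqP; rewrite eq_le; apply/andP; split.
      by have := qub 0 _ _ C0; rewrite subr0 addr0 sublinear0.
    by apply/qlb => y r Cyr; rewrite add0r subr_ge0; exact: Cp.
  apply/eqP; rewrite eq_le qZ// andbT -ler_pdivrMl//.
  have t0V : 0 < t^-1 by rewrite invr_gt0.
  have := qZ t^-1 (t *: x) t0V.
  by rewrite scalerA mulVf ?gt_eqF// scale1r.
- by move=> x; have := qub x _ _ C0; rewrite addr0 subr0.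
- move=> y r Cyr; have := qub (- y) _ _ Cyr.
  by rewrite addNr sublinear0// sub0r.
Qed.

(** Zorn's lemma gives a minimal sublinear functional m below q. Lowering m
along the ray of y, with the values prescribed by m itself, cannot change it,
so m (- y) <= - m y; an odd sublinear functional is linear. *)
Lemma linear_below_sublinear {q} : sublinear q ->
  exists m : {linear X -> R^o}, forall x, m x <= q x.
Proof.
move=> sq; pose T := {m | sublinear m /\ forall x, m x <= q x}.
pose t0 : T := exist _ q (conj sq (fun x => lexx (q x))).
pose leT (s t : T) := `[< forall x, sval t x <= sval s x >].
have [|r s t /asboolP rs /asboolP st|A Atot|[m [sm mq]] mmin] :=
    @ZL_preorder T t0 leT.
- by move=> t; exact/asboolP.
- by apply/asboolP => x; exact: le_trans (st x) (rs x).
(* A nonempty chain is bounded by its pointwise infimum. *)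
- have [[a Aa]|/forallNP A0] := pselect (exists a, A a); last first.
    by exists t0 => s /A0.
  pose B x := [set sval s x | s in A].
  have infB x : has_inf (B x).
    split; first by exists (sval a x), a.
    exists (- q (- x)) => _ [[s [ss sq']] /= As <-].
    by have := sublinear_opp_ge x ss; have := sq' (- x); lra.
  have mub x s : A s -> inf (B x) <= sval s x.
    by move=> As; apply: ge_inf; [case: (infB x)|exists s].
  have mlb x z : (forall s, A s -> z <= sval s x) -> z <= inf (B x).
    move=> zB; apply: lb_le_inf; first by case: (infB x).
    by move=> _ [s /= As <-]; exact: zB.
  have mZ t x : 0 < t -> t * inf (B x) <= inf (B (t *: x)).
    move=> t_gt0; apply/mlb => s As; have [_ sZ] := (svalP s).1.
    by rewrite (sZ _ _ (ltW t_gt0)) ler_pM2l// mub.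
  have sm : sublinear (fun x => inf (B x)).
    split=> [x y|t x] /=.
      rewrite -lerBlDr; apply/mlb => s As.
      rewrite lerBlDr -lerBlDl; apply/mlb => s' As'; rewrite lerBlDl.
      have [u [Au us us']] : exists u, [/\ A u, sval u x <= sval s x &
          sval u y <= sval s' y].
        have [/asboolP ss'|/asboolP s's] := Atot _ _ As As'.
          by exists s'; split.
        by exists s; split.
      have [uD _] := (svalP u).1.
      by rewrite (le_trans (mub _ _ Au))// (le_trans (uD _ _))// lerD.
    rewrite le_eqVlt => /predU1P[<-|t_gt0].
      rewrite mul0r scale0r; apply/eqP; rewrite eq_le; apply/andP; split.
        by rewrite -(sublinear0 (svalP a).1) mub.
      by apply/mlb => s As; rewrite (sublinear0 (svalP s).1).
    apply/eqP; rewrite eq_le mZ// andbT -ler_pdivrMl//.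
    have tV_gt0 : 0 < t^-1 by rewrite invr_gt0.
    have := mZ t^-1 (t *: x) tV_gt0.
    by rewrite scalerA mulVf ?gt_eqF// scale1r.
  have mq x : inf (B x) <= q x by rewrite (le_trans (mub x _ Aa))// (svalP a).2.
  exists (exist _ (fun x => inf (B x)) (conj sm mq) : T) => s As.
  by apply/asboolP => x; exact: mub.
- have [mD mZ] := sm.
  have modd y : m (- y) = - m y.
    have [|||||m' [sm' m'm m'y]] :=
      @sublinear_depress m [set c | exists2 t, 0 <= t & c = (t *: y, t * m y)].
    - exact: sm.
    - by exists 0; rewrite ?scale0r ?mul0r.
    - move=> _ _ _ _ [t t_ge0 [-> ->]] [t' t'_ge0 [-> ->]].
      by exists (t + t'); rewrite ?addr_ge0// scalerDl mulrDl.
    - move=> t _ _ t_ge0 [t' t'_ge0 [-> ->]].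
      by exists (t * t'); rewrite ?mulr_ge0// scalerA mulrA.
    - by move=> _ _ [t t_ge0 [-> ->]]; rewrite mZ.
    have m'q x : m' x <= q x := le_trans (m'm x) (mq x).
    have /asboolP /(_ (- y)) /= mm' :=
      mmin (exist _ m' (conj sm' m'q) : T) (introT (asboolP _) m'm).
    apply/eqP; rewrite eq_le; apply/andP; split; last first.
      by rewrite lerNl sublinear_opp_ge.
    by apply: le_trans mm' _; apply: m'y; exists 1; rewrite ?scale1r ?mul1r.
  have mDE x y : m (x + y) = m x + m y.
    apply/eqP; rewrite eq_le mD /=.
    by have := mD (- x) (- y); rewrite -opprD !modd; lra.
  have ml : linear (m : X -> R^o).
    move=> t x y; rewrite mDE; congr (_ + _).
    have [t_ge0|t_lt0] := leP 0 t; first by rewrite mZ.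
    have nt_ge0 : 0 <= - t by rewrite oppr_ge0 ltW.
    by rewrite -[t]opprK scaleNr modd mZ// scaleNr.
  pose M : {linear X -> R^o} :=
    HB.pack (m : X -> R^o) (GRing.isLinear.Build _ _ _ _ _ ml).
  by exists M.
Qed.

(** The subspace carrying the functional to be extended is presented as the
range of a linear map J, and the functional by its composite h with J; h
factors through J because h <= p \o J. The inequality h <= m \o J comes from the
constraint cone of all (J a, h a), and its converse from applying it to - a. *)
Lemma hahn_banach {L : lmodType R} (J : {linear L -> X})
    (h : {linear L -> R^o}) p :
  sublinear p -> (forall a, h a <= p (J a)) ->
  exists m : {linear X -> R^o},
    (forall x, m x <= p x) /\ forall a, m (J a) = h a.
Proof.
move=> sp hp.
have [|||||q [sq qp qh]] :=
  @sublinear_depress p [set (J a, h a : R) | a in setT].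
- exact: sp.
- by exists 0; rewrite ?linear0.
- move=> _ _ _ _ [a _ [<- <-]] [b _ [<- <-]].
  by exists (a + b); rewrite ?linearD.
- by move=> t _ _ _ [a _ [<- <-]]; exists (t *: a); rewrite ?linearZ.
- by move=> _ _ [a _ [<- <-]].
have [m mq] := linear_below_sublinear sq.
exists m; split=> [x|a]; first exact: le_trans (mq x) (qp x).
have mh b : h b <= m (J b).
  rewrite -lerN2 -linearN (le_trans (mq _))//.
  by apply: qh; exists b.
apply/eqP; rewrite eq_le mh andbT -lerN2 -!linearN; exact: mh.
Qed.

End HahnBanach.

(** * Weakly unconditionally Cauchy sequences have bounded weak 1-norms *)

Section BopComplete.
Context {R : realType} {E : normedModType R} {W : completeNormedModType R}.

(** Completeness is needed for the dual of E, to which the uniform boundedness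
principle is applied below. *)
Lemma bop_complete (A : set_system (bop E W)) :
  ProperFilter A -> cauchy A -> cvg A.
Proof.
move=> PA /cauchy_ballP Ac.
have Ad e : 0 < e -> \forall f & g \near A, `|g - f| <= e.
  move=> e0; apply: filterS (Ac _ e0) => -[f g] /=.
  by rewrite -ball_normE /= distrC => /ltW.
have cvx x : cvg ((fun f : bop E W => f x) @ A).
  apply: cauchy_cvg; apply/cauchy_ballP => e e0.
  have x0 : 0 < `|x| + 1 by rewrite ltr_wpDl.
  rewrite near_map2; apply: filterS (Ac _ (divr_gt0 e0 x0)) => -[f g] /=.
  rewrite -!ball_normE /= ltr_pdivlMr// => fg.
  rewrite -[f x - g x]/((f - g) x) (le_lt_trans (opnorm_bound _ _))//.
  by rewrite (le_lt_trans _ fg)// [leRHS]mulrDr lerDl mulr1.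
pose g x := lim ((fun f : bop E W => f x) @ A).
have gx x : (fun f : bop E W => f x) @ A --> g x by exact: cvx.
have gl : linear g.
  move=> a x y.
  apply: (@cvg_unique _ _ ((fun f : bop E W => f (a *: x + y)) @ A)).
  - exact: norm_hausdorff.
  - exact: gx.
  - have -> : (fun f : bop E W => f (a *: x + y)) =
        (fun f => a *: f x + f y).
      by apply/funext => f; rewrite bop_is_linear.
    by apply: cvgD; [apply: cvgZr|].
(* A bound valid near A passes to the pointwise limit; this gives at once the
   boundedness of g and the convergence in norm. *)
have gdist f0 e : (\forall f \near A, `|f - f0| <= e) ->
    forall x, `|g x - f0 x| <= e * `|x|.
  move=> fe x; apply: (@cvgr_to_le _ A _ R (fun f : bop E W => `|f x - f0 x|)).
    by apply: cvg_norm; apply: cvgB => //; exact: cvg_cst.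
  apply: filterS fe => f fe; rewrite -[f x - f0 x]/((f - f0) x).
  by rewrite (le_trans (opnorm_bound _ _))// ler_wpM2r.
have [f0 Af0] : exists f0, \forall f \near A, `|f - f0| <= 1.
  have /cauchy_ballP/cauchyP/(_ 1 ltr01) [f0 Af0] := Ac.
  by exists f0; apply: filterS Af0 => f /=; rewrite -ball_normE distrC => /ltW.
have gB : g \in @is_bop R E W.
  apply/asboolP; split=> //; exists (`|f0| + 1) => x.
  rewrite -[g x](subrK (f0 x)) addrC (le_trans (ler_normD _ _))// mulrDl.
  by rewrite lerD ?opnorm_bound ?gdist.
apply/cvg_ex; exists (Bop gB); apply/cvgrPdist_le => e e0.
near=> f; apply: opnorm_le => [|x]; first exact: ltW.
apply: (gdist f e); near: f; apply: nearP_dep; exact: Ad.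
Unshelve. all: by end_near. Qed.

HB.instance Definition _ := Uniform_isComplete.Build (bop E W) bop_complete.
End BopComplete.

Section WUC.
Context {R : realType} {E : normedModType R}.

Lemma wuc_partial_le {x : nat -> E} (f : bop E R^o) n : weakly_unc_cauchy x ->
  \sum_(i < n) `|f (x i)| <= fine (\sum_(0 <= i <oo) (`|f (x i)|)%:E)%E.
Proof.
move=> wx.
have s0 : (0 <= \sum_(0 <= i <oo) (`|f (x i)|)%:E)%E.
  by apply: nneseries_ge0 => *; rewrite lee_fin.
rewrite -lee_fin fineK ?ge0_fin_numE//.
apply: le_trans (nneseries_lim_ge n _); last by move=> *; rewrite lee_fin.
by rewrite big_mkord sumEFin.
Qed.

(** On the dual of E, the functionals sending f to the sum over i < n of
s_i f(x_i), with coefficients s_i in [-1, 1], are pointwise bounded by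
weak unconditional Cauchyness, hence uniformly bounded on the unit ball.
For fixed f the signs s_i = sg f(x_i) recover the sum of the |f(x_i)|. *)
Lemma wuc_weak1_bounded {x : nat -> E} : weakly_unc_cauchy x ->
  exists M, forall n, weak1 (fun i : 'I_n => x i) <= M.
Proof.
move=> wx.
pose B : set (bop E R^o -> R^o) := [set phi | exists n, exists2 s : nat -> R,
  forall i, `|s i| <= 1 &
  phi = fun f : bop E R^o => (\sum_(i < n) s i * f (x i) : R)].
have [|f|M BM] := @Banach_Steinhauss R (bop E R^o) R^o B _ _ 1.
- move=> _ [n [s s1 ->]]; split.
    move=> r; exists (\sum_(i < n) r * `|x i|) => f fr.
    rewrite (le_trans (ler_norm_sum _ _ _))// ler_sum// => i _.
    rewrite normrM (le_trans (ler_piMl _ _))//.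
    by rewrite (le_trans (opnorm_bound _ _))// ler_wpM2r.
  move=> a f g; rewrite scaler_sumr -big_split/=; apply: eq_bigr => i _.
  by have := mulrDr (s i) (a * f (x i)) (g (x i)); rewrite mulrCA.
- exists (fine (\sum_(0 <= i <oo) (`|f (x i)|)%:E)%E) => _ [n [s s1 ->]].
  apply: le_trans (wuc_partial_le f n wx).
  rewrite (le_trans (ler_norm_sum _ _ _))// ler_sum// => i _.
  by rewrite normrM ler_piMl.
exists M => n; apply: ge_sup.
  by case: (weak1_has_sup (fun i : 'I_n => x i)).
move=> _ [f /= f1 <-].
have /BM/(_ _ f1) : B (fun g => \sum_(i < n) Num.sg (f (x i) : R) * g (x i)).
  exists n, (fun i => Num.sg (f (x i) : R)) => // i.
  by rewrite normr_sg lern1; case: eqP.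
move/(le_trans (ler_norm _)); apply: le_trans.
rewrite le_eqVlt; apply/orP; left.
by apply/eqP/eq_bigr => i _; exact: (normrEsg (f (x i) : R)).
Qed.

End WUC.

(** * Embeddings of l1 and their biorthogonal functionals *)

Section L1Lemmas.
Context {R : realType}.
Implicit Types (u : nat -> R) (a : l1 R).

(** A bound on all partial sums both places u in l1 and bounds its norm; the
second part is stated for every membership proof so that it applies to elements
of l1 defined through the first. *)
Lemma l1_of_bound {u B} : (forall n, \sum_(i < n) `|u i| <= B) ->
  u \in is_l1 /\ forall ul : u \in is_l1, `|MkL1 ul| <= B.
Proof.
move=> uB.
have sB : (\sum_(0 <= i <oo) (`|u i|)%:E <= B%:E)%E.
  apply: lime_le; first by apply: is_cvg_nneseries => *; rewrite lee_fin.
  by apply: nearW => n; rewrite big_mkord sumEFin lee_fin.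
split; first by rewrite inE (le_lt_trans sB)// ltry.
by move=> ul; rewrite -lee_fin l1_normE.
Qed.

Lemma l1_partial_le a n : \sum_(i < n) `|a i| <= `|a|.
Proof.
rewrite -lee_fin l1_normE.
apply: le_trans (nneseries_lim_ge n _); last by move=> *; rewrite lee_fin.
by rewrite big_mkord sumEFin.
Qed.

Lemma l1_coord_le a n : `|a n| <= `|a|.
Proof.
apply: le_trans (l1_partial_le a n.+1).
by rewrite big_ord_recr/= lerDr sumr_ge0.
Qed.

Definition l1_coord n (a : l1 R) : R^o := a n.

Lemma l1_coord_is_linear n : linear (l1_coord n).
Proof. by []. Qed.

HB.instance Definition _ n :=
  GRing.isLinear.Build R (l1 R) R^o *:%R (l1_coord n) (l1_coord_is_linear n).

End L1Lemmas.

Lemma bounded_linear_continuousP {R : realType} {X Y : normedModType R}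
  (f : {linear X -> Y}) :
  continuous f <-> exists2 C, 0 <= C & forall x, `|f x| <= C * `|x|.
Proof.
split=> [/linear_bounded_continuous/linear_boundedP|[C C0 fC]].
  by move=> /pinfty_ex_gt0[C C0 fC]; exists C => //; exact: ltW.
apply/bounded_linear_continuous/linear_boundedP; near=> r => x.
by rewrite (le_trans (fC x))// ler_wpM2r//; near: r; exact: nbhs_pinfty_ge.
Unshelve. all: by end_near. Qed.

(** J (Q x) is a projection onto the range of J, and this range is closed as the
zero set of the continuous map sending x to J (Q x) - x. *)
Lemma complemented_copy_of_retraction {R : realType} {X : normedModType R}
  (J : {linear l1 R -> X}) (Q : {linear X -> l1 R}) :
  continuous J -> continuous Q -> cancel J Q -> has_complemented_copy_l1 X.
Proof.
move=> Jc Qc JQ.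
have PB : (J \o Q) \in @is_bop R X X.
  have [C C0 JC] := (bounded_linear_continuousP J).1 Jc.
  have [D D0 QD] := (bounded_linear_continuousP Q).1 Qc.
  apply/asboolP; split; first by move=> t x y; rewrite /= !linearP.
  exists (C * D) => x /=; rewrite (le_trans (JC _))// -mulrA ler_wpM2l//.
have JE : J @` setT = [set x | J (Q x) - x = 0].
  apply/seteqP; split=> [_ [a _ <-]|x /= /subr0_eq Px] /=.
    by rewrite JQ subrr.
  by exists (Q x).
exists (J @` setT); split.
- split.
    split; first by apply/mem_set; exists 0; rewrite ?linear0.
    move=> t x y /set_mem[a _ <-] /set_mem[b _ <-]; apply/mem_set.
    by exists (t *: a + b); rewrite ?linearP.
  rewrite JE; apply: (@closed_comp _ _ (fun x => J (Q x) - x) [set 0]).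
    move=> x _; apply: cvgB => //.
    by apply: (continuous_comp (Qc x)); exact: Jc.
  exact/accessible_closed_set1/hausdorff_accessible/norm_hausdorff.
- by exists J, Q; split=> //; exact: continuous_subspaceT.
- exists (Bop PB); split=> [x|] /=; first by rewrite JQ.
  apply/seteqP; split=> [_ [x _ <-]|_ [a _ <-]]; first by exists (Q x).
  by exists (J a) => //=; rewrite JQ.
Qed.

(** Continuity of the inverse at the origin gives d > 0 such that |J a| < d forces
|a| < 1; rescaling a to make |J a| = d / 2 gives the bound with K = 2 / d. *)
Lemma homeomorphic_embedding_bounds {R : realType} {X : normedModType R}
    {S : set X} : homeomorphic_to_l1 S ->
  exists (J : {linear l1 R -> X}) (K : R), [/\ continuous J, 0 <= K &
    forall a, `|a| <= K * `|J a|].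
Proof.
move=> [J [G [Jc JS JG Gc]]]; exists J.
have S0 : S 0 by rewrite -JS; exists 0; rewrite ?linear0.
have G0 : G 0 = 0 by rewrite -(linear0 J) JG.
have [d d0 dG] : exists2 d, 0 < d & forall a, `|J a| < d -> `|a| < 1.
  have /cvgrPdist_lt/(_ 1 ltr01) Gc0 := Gc 0.
  have : within S (nbhs (0 : X)) [set z | `|G 0 - G z| < 1].
    by rewrite nbhs_subspace_in.
  move=> /nbhs_norm0P[d d0 dG]; exists d => // a Jad.
  have := dG (J a) Jad; rewrite /= JG G0 sub0r normrN; apply.
  by rewrite -JS; exists a.
exists (2 / d); split=> //; first by rewrite divr_ge0// ltW.
move=> a; have [Ja0|Ja0] := eqVneq (J a) 0.
  have -> : a = 0 by rewrite -(JG a) Ja0.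
  by rewrite normr0 mulr_ge0// divr_ge0// ltW.
have nJ : 0 < `|J a| by rewrite normr_gt0.
pose t := d / (2 * `|J a|).
have t0 : 0 < t by rewrite divr_gt0// mulr_gt0.
have := dG (t *: a).
rewrite linearZ (normrZ _ (J a)) (normrZ _ a) (gtr0_norm t0).
have -> : t * `|J a| = d / 2.
  by rewrite /t invfM mulrA mulfVK// gt_eqF.
rewrite ltr_pdivrMr// ltr_pMr// ltr1n => /(_ isT)/ltW.
by rewrite -ler_pdivlMl// mulr1 invf_div mulrAC.
Qed.

(** The n-th coordinate is dominated by the norm of l1, hence by K |J a|,
whatever n is; so the Hahn-Banach extensions have the common bound K. *)
Lemma l1_biorthogonal {R : realType} {X : normedModType R}
    (J : {linear l1 R -> X}) {K : R} : 0 <= K ->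
  (forall a, `|a| <= K * `|J a|) ->
  exists g : nat -> {linear X -> R^o}, forall n,
    (forall y, `|g n y| <= K * `|y|) /\ forall a, g n (J a) = a n.
Proof.
move=> K0 JK.
have sK : sublinear (fun y : X => K * `|y|).
  split=> [x y|t x t0]; first by rewrite -mulrDr ler_wpM2l// ler_normD.
  by rewrite normrZ ger0_norm// mulrCA.
have gP n : exists g : {linear X -> R^o},
    (forall y, `|g y| <= K * `|y|) /\ forall a, g (J a) = a n; last first.
  by have [g gE] := choice gP; exists g.
have [|m [mK mJ]] := hahn_banach J (l1_coord n) _ sK.
  by move=> a; rewrite (le_trans (ler_norm _))// (le_trans (l1_coord_le a n)).
exists m; split=> // y; rewrite [leLHS]/(`|m y : R|) ler_norml mK andbT.
by rewrite lerNl -linearN (le_trans (mK _))// normrN.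
Qed.

(** * Diagonal operators and their left inverse *)

Section Pi1Criterion.
Context {R : realType} {E F : normedModType R}.

(** The finite inequalities pass to infinite sequences because the weak 1-norms
of the initial segments of a weakly unconditionally Cauchy sequence are bounded. *)
Lemma pi1_bound_abs1summing (T : bop E F) rho : 0 <= rho -> pi1_bound T rho ->
  T \in @abs1summing R E F.
Proof.
move=> rho0 Trho; apply/asboolP => x wx.
have [M xM] := wuc_weak1_bounded wx.
have [|+ _] := @l1_of_bound R (fun n => `|T (x n)|) (rho * M).
  move=> n; under eq_bigr do rewrite normr_id.
  by rewrite (le_trans (Trho _ _))// ler_wpM2l.
by rewrite inE; under eq_eseriesr do rewrite normr_id.
Qed.

End Pi1Criterion.

Section DiagonalOperators.
Context {R : realType} {E F : normedModType R} {xs : nat -> bop E R^o}.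
Context {J : {linear l1 R -> F}} {C : R}.
Hypotheses (xs1 : forall n, `|xs n| <= 1) (C0 : 0 <= C)
  (JC : forall a, `|J a| <= C * `|a|).

Lemma xs_le n y : `|xs n y| <= `|y|.
Proof. by rewrite (le_trans (opnorm_bound _ _))// ler_piMl//; exact: xs1. Qed.

Let multiplied_bound (a : l1 R) (y : E) n :
  \sum_(i < n) `|a i * xs i y| <= `|a| * `|y|.
Proof.
rewrite (@le_trans _ _ (\sum_(i < n) `|a i| * `|y|))//.
  by apply: ler_sum => i _; rewrite normrM ler_wpM2l// xs_le.
by rewrite -mulr_suml ler_wpM2r// l1_partial_le.
Qed.

Definition multiplied (a : l1 R) (y : E) : l1 R :=
  @MkL1 R (fun n => a n * xs n y) (l1_of_bound (multiplied_bound a y)).1.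

Lemma multipliedDl a b y t :
  multiplied (t *: a + b) y = t *: multiplied a y + multiplied b y.
Proof.
apply/val_inj/funext => n /=.
by rewrite -[LHS]/((t * a n + b n) * xs n y) mulrDl -mulrA.
Qed.

Lemma multipliedDr a y z t :
  multiplied a (t *: y + z) = t *: multiplied a y + multiplied a z.
Proof.
apply/val_inj/funext => n /=; rewrite bop_is_linear.
by have := mulrDr (a n) (t * xs n y) (xs n z); rewrite mulrCA.
Qed.

Lemma multiplied_norm_le a y : `|multiplied a y| <= `|a| * `|y|.
Proof. exact: (l1_of_bound (multiplied_bound a y)).2. Qed.

(** The sum over the y_i is exchanged with the series over the coordinates; for
each coordinate n the inner sum is at most |a_n| weak1 y, as |xs_n| <= 1. *)
Lemma multiplied_sum_le a n (y : 'I_n -> E) :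
  \sum_(i < n) `|multiplied a (y i)| <= `|a| * weak1 y.
Proof.
rewrite -lee_fin -sumEFin.
under eq_bigr do rewrite l1_normE.
rewrite -nneseries_sum; last by move=> *; rewrite lee_fin.
rewrite mulrC EFinM l1_normE -nneseriesZl; last by move=> *; rewrite lee_fin.
apply: lee_nneseries => [k _ _|k _].
  by rewrite sume_ge0// => *; rewrite lee_fin.
rewrite sumEFin -EFinM lee_fin.
under eq_bigr do rewrite /= normrM.
rewrite -mulr_sumr mulrC ler_wpM2r//.
by rewrite (le_trans (weak1_bound _ _))// ler_piMl ?weak1_ge0.
Qed.

Lemma diag_op_is_bop a : (fun y => J (multiplied a y)) \in @is_bop R E F.
Proof.
apply/asboolP; split; first by move=> t y z; rewrite multipliedDr linearP.
exists (C * `|a|) => y; rewrite (le_trans (JC _))// -mulrA ler_wpM2l//.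
exact: multiplied_norm_le.
Qed.

Lemma diag_op_pi1_bound a : pi1_bound (Bop (diag_op_is_bop a)) (C * `|a|).
Proof.
move=> n y /=.
rewrite (@le_trans _ _ (\sum_(i < n) C * `|multiplied a (y i)|))//.
  by apply: ler_sum => i _; exact: JC.
by rewrite -mulr_sumr -mulrA ler_wpM2l// multiplied_sum_le.
Qed.

Lemma diag_op_abs1summing a : Bop (diag_op_is_bop a) \in @abs1summing R E F.
Proof.
by apply: pi1_bound_abs1summing (diag_op_pi1_bound a); rewrite mulr_ge0.
Qed.

(** The sum over n of the rank-one operators sending y to a_n xs_n(y) J(e_n), for
e_n the unit vectors of l1. Applying J to an element of l1 that depends on y
defines it without a series of operators. *)
Definition diag_op (a : l1 R) : Pi1 E F := MkPi1 (diag_op_abs1summing a).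

Lemma diag_op_is_linear : linear diag_op.
Proof.
move=> t a b; do 2 apply/val_inj; apply/funext => y /=.
by rewrite multipliedDl linearP.
Qed.

HB.instance Definition _ :=
  GRing.isLinear.Build R (l1 R) (Pi1 E F) *:%R diag_op diag_op_is_linear.

Lemma diag_op_continuous : continuous diag_op.
Proof.
apply/bounded_linear_continuousP; exists C => // a.
by apply: pi1_le (diag_op_pi1_bound a); rewrite mulr_ge0.
Qed.

End DiagonalOperators.

Section Evaluation.
Context {R : realType} {E F : normedModType R} {x : nat -> E}.
Context {g : nat -> {linear F -> R^o}} {K : R}.
Hypotheses (wx : weakly_unc_cauchy x) (K0 : 0 <= K)
  (gK : forall n y, `|g n y| <= K * `|y|).

Let evaluation_bound : exists2 M, 0 <= M & forall (T : Pi1 E F) n,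
  \sum_(i < n) `|g i (T (x i))| <= M * `|T|.
Proof.
have [M xM] := wuc_weak1_bounded wx; exists (K * M).
  by rewrite mulr_ge0// (le_trans _ (xM 0%N))// weak1_ge0.
move=> T n; rewrite (@le_trans _ _ (\sum_(i < n) K * `|T (x i)|))//.
  exact: ler_sum.
rewrite -mulr_sumr -mulrA ler_wpM2l// (le_trans (pi1_boundP _ _))// mulrC.
by rewrite ler_wpM2r// pi1_ge0.
Qed.

Lemma evaluation_in_l1 (T : Pi1 E F) : (fun n => g n (T (x n)) : R) \in is_l1.
Proof.
have [M _ xM] := evaluation_bound.
exact: (l1_of_bound (xM T)).1.
Qed.

(** When g_n (J a) = a_n for all a, and xs_n (x_n) = 1, the n-th term takes the
value a_n on [diag_op a]: this is the left inverse of diag_op. *)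
Definition evaluation (T : Pi1 E F) : l1 R := MkL1 (evaluation_in_l1 T).

Lemma evaluation_is_linear : linear evaluation.
Proof.
move=> t T U; apply/val_inj/funext => n /=.
exact: (linearP (g n) t (T (x n)) (U (x n))).
Qed.

HB.instance Definition _ :=
  GRing.isLinear.Build R (Pi1 E F) (l1 R) *:%R evaluation evaluation_is_linear.

Lemma evaluation_continuous : continuous evaluation.
Proof.
apply/bounded_linear_continuousP; have [M M0 xM] := evaluation_bound.
exists M => // T; exact: (l1_of_bound (xM T)).2.
Qed.

End Evaluation.

Theorem theorem2 (R : realType) (E F : completeNormedModType R) :
  (exists (x : nat -> E) (xs : nat -> bop E R^o)
          (xss : bop (bop E R^o) R^o) (eps : R),
    [/\ weakly_unc_cauchy x,
        forall n : nat, `|xs n| <= 1,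
        0 < eps &
        forall n : nat, xs n (x n) = 1 /\ eps < xss (xs n)]) ->
  has_copy_l1 F -> has_complemented_copy_l1 (Pi1 E F).
Proof.
move=> [x [xs [xss [eps [wx xs1 _ xsx]]]]] [S [_ SJ]].
have [J [K [Jc K0 JK]]] := homeomorphic_embedding_bounds SJ.
have [C C0 JC] := (bounded_linear_continuousP J).1 Jc.
have [g gE] := l1_biorthogonal J K0 JK.
have gK n y : `|g n y| <= K * `|y| by have [] := gE n.
apply: (@complemented_copy_of_retraction _ _
  (diag_op xs1 C0 JC) (evaluation wx K0 gK)).
- exact: diag_op_continuous.
- exact: evaluation_continuous.
move=> a; apply/val_inj/funext => n /=.
have [_ ->] := gE n.
by rewrite /= (xsx n).1 mulr1.
Qed.
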